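(* Let $\alpha>0$. Then $$\dim_{\mathrm{H}}\left\{x\in(0,1]:\lim_{n\to\infty}\frac{L_n(x)}{\log_2 n}=\alpha\right\}=1,$$ where $L_n(x)=\max\{d_i(x):1\le i\le n\}$.
   Context: $\mathbb{N}=\{1,2,3,\dots\}$; $\dim_{\mathrm{H}}$ denotes Hausdorff dimension. Every $x\in(0,1]$ has a unique expansion $x=\sum_{i=1}^{\infty}2^{-(d_1(x)+d_2(x)+\cdots+d_i(x))}$ with all $d_i(x)\in\mathbb{N}$ (the power-2-decaying Gauss-like expansion); this defines the digit functions $d_i:(0,1]\to\mathbb{N}$. Equivalently, with $T:(0,1]\to(0,1]$ given by $Tx=2^nx-1$ for $x\in(2^{-n},2^{-(n-1)}]$, $n\in\mathbb{N}$, the digit $d_i(x)$ is the unique $n\in\mathbb{N}$ with $T^{i-1}x\in(2^{-n},2^{-(n-1)}]$. *)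

(* Defs.v *)
From HB Require Import structures.
From mathcomp Require Import all_boot all_order all_algebra.
From mathcomp Require Import all_classical all_reals all_analysis.

Set Implicit Arguments.
Unset Strict Implicit.
Unset Printing Implicit Defensive.

Import Order.TTheory GRing.Theory Num.Theory.
Import numFieldNormedType.Exports.

Local Open Scope classical_set_scope.
Local Open Scope ring_scope.

Section Hausdorff.
Context {R : realType}.
Implicit Types (A U : set R) (s delta : R).

(* Adjoining 0 makes the diameter of set0 equal to 0 rather than -oo. *)
Definition diam U : \bar R :=
  ereal_sup ([set 0%E] `|` [set `|x - y|%:E | x in U & y in U]).

(* The empty set has weight 0 even when s = 0, so that covers by finitely many
   sets are covers by sequences. A nonempty set of diameter 0 has weight 1 when
   s = 0. *)
Definition diam_pow s U : \bar R :=
  if U == set0 then 0%E else (diam U `^ s)%E.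

Definition delta_cover delta A : set (nat -> set R) :=
  [set F | A `<=` \bigcup_i F i /\ forall i, (diam (F i) <= delta%:E)%E].

Definition hausdorff_content delta s A : \bar R :=
  ereal_inf [set (\sum_(0 <= i <oo) diam_pow s (F i))%E
            | F in delta_cover delta A].

(* The supremum is the limit as delta tends to 0, since hausdorff_content is
   nonincreasing in delta. *)
Definition hausdorff_measure s A : \bar R :=
  ereal_sup [set hausdorff_content delta s A | delta in [set e : R | 0 < e]].

Definition hausdorff_dim A : \bar R :=
  ereal_inf [set s%:E | s in [set s : R | 0 <= s /\ hausdorff_measure s A = 0%E]].

End Hausdorff.

Section Digits.
Context {R : realType}.
Implicit Types (x : R) (d : nat -> nat) (i n : nat).

(* Indices start at 1; the value d 0 plays no role. *)
Definition is_expansion x d : Prop :=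
  (forall i, (1 <= i)%N -> (1 <= d i)%N) /\
  (\sum_(1 <= i < n.+1) (2 : R) ^- (\sum_(1 <= j < i.+1) d j)%N)
    @[n --> \oo] --> x.

(* Every x in ]0, 1] has an expansion, and its digits of index at least 1 are
   unique; the default value is only reached outside ]0, 1]. *)
Definition digit i x : nat := xget (fun=> 0%N) (is_expansion x) i.

Definition max_digit n x : nat := (\max_(1 <= i < n.+1) digit i x)%N.

Definition log2 x : R := ln x / ln 2.

End Digits.

(* Main.v *)
Require Import Defs.
From HB Require Import structures.
From mathcomp Require Import all_boot all_order all_algebra.
From mathcomp Require Import all_classical all_reals all_analysis.
From mathcomp Require Import zify ring lra.

Set Implicit Arguments.
Unset Strict Implicit.
Unset Printing Implicit Defensive.

Import Order.TTheory GRing.Theory Num.Theory.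
Import numFieldNormedType.Exports.

Local Open Scope classical_set_scope.
Local Open Scope ring_scope.

(* Lower bound: fix j and consider digit sequences cut into blocks of j + 1
   digits. In block q the first digit is 1 + floor (alpha v) where v is the
   2-adic valuation of q + 1, and the j others form a free word of sum at most
   2j. The maximum of v over q < n is floor (log_2 n), which gives the limit
   alpha, while the sum of these valuations is less than n, so the forced digits
   cost a bounded amount per block. There are 'C(2j, j) >= 4^j / (2j + 1) words,
   so reading u in [0, 1[ in base 'C(2j, j) and turning its digits into words
   gives a map g such that |u - v| <= C |g u - g v| ^ s, where s -> 1 as j grows.
   Pulling covers back along g then bounds the Hausdorff measure of dimension s
   below by Lebesgue measure. *)

(** * Counting words, block sequences and 2-adic valuations *)

(** Induction on [j]: consecutive central binomials have ratio [2 * (2j + 1) / (j + 1)], and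
    [2 * (2j + 3) >= 4 * (j + 1)]. *)
Lemma exp4_le_central_bin j : (4 ^ j <= j.*2.+1 * 'C(j.*2, j))%N.
Proof.
elim: j => [|j IH] //.
have h1 := mul_bin_diag j.*2.+2 j; have h2 := mul_bin_down j.*2.+1 j.
rewrite /= in h1 h2; rewrite doubleS expnS.
have {}h2 : (j.*2.+1 * 'C(j.*2, j) = j.+1 * 'C(j.*2.+1, j))%N.
  by rewrite h2; congr (_ * _)%N; lia.
have {}h1 : ('C(j.*2.+2, j.+1) = 2 * 'C(j.*2.+1, j))%N.
  apply/eqP; rewrite -(eqn_pmul2l (ltn0Sn j)) -h1; apply/eqP; lia.
rewrite h1; move: IH; rewrite h2; nia.
Qed.

(* [w k] enumerates, for k below ['C(j.*2, j)], the words of [j] positive digits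
   with sum at most [j.*2]. *)
Lemma exists_words j : exists w : nat -> nat -> nat,
  [/\ forall k r, (1 <= w k r <= j.+1)%N,
      forall k, (\sum_(r < j) w k r <= j.*2)%N &
      forall k k', (k < 'C(j.*2, j))%N -> (k' < 'C(j.*2, j))%N ->
        (forall r, (r < j)%N -> w k r = w k' r) -> k = k'].
Proof.
(* Subtracting 1 from each digit turns the words into [j]-tuples over [0..j] of sum at most [j],
   which ['C(j + j, j)] counts. *)
pose A := [set t : j.-tuple 'I_j.+1 | (\sum_(i <- t) i <= j)%N]%SET.
have cA : #|A| = 'C(j.*2, j) by rewrite card_partial_ord_partitions addnn.
(* The zero tuple is the default for out-of-range [k], so that the bounds on [w k] hold for every
   [k]. *)
pose t0 : j.-tuple 'I_j.+1 := [tuple of nseq j ord0].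
have sum_t0 : (\sum_(i <- t0) i = 0)%N.
  by rewrite big1_seq//= => i; rewrite mem_nseq => /andP[_ /eqP->].
pose wd k := nth t0 (enum A) k.
have wdP k : (\sum_(i <- wd k) i <= j)%N.
  have [kA|kA] := ltnP k (size (enum A)); last by rewrite /wd nth_default// sum_t0.
  by have := mem_nth t0 kA; rewrite mem_enum inE.
exists (fun k r => (nth ord0 (wd k) r).+1); split.
- by move=> k r; rewrite ltnS ltn_ord.
- move=> k; have := wdP k.
  rewrite (big_nth ord0) big_mkord size_tuple => h.
  under eq_bigr do rewrite -addn1.
  by rewrite big_split/= sum1_card card_ord -addnn leq_add2r.
- move=> k k' hk hk' e; rewrite -cA cardE in hk hk'.
  apply/eqP; rewrite -(nth_uniq t0 hk hk' (enum_uniq _)); apply/eqP.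
  apply: val_inj; apply: (@eq_from_nth _ ord0) => [|r]; first by rewrite !size_tuple.
  by rewrite size_tuple => /e [] /val_inj.
Qed.

(* Index [i] starts at 1; the value at 0 is junk. *)
Definition blocks j (e : nat -> nat) (w : nat -> nat -> nat) (i : nat) : nat :=
  if (i.-1 %% j.+1)%N is r.+1 then w (i.-1 %/ j.+1)%N r else e (i.-1 %/ j.+1)%N.

Lemma blocks0 j e w q : blocks j e w (q * j.+1).+1 = e q.
Proof. by rewrite /blocks /= modnMl mulnK. Qed.

Lemma blocksS j e w q r : (r < j)%N -> blocks j e w (q * j.+1 + r.+1).+1 = w q r.
Proof.
move=> rj; rewrite /blocks /= modnMDl modn_small ?ltnS//.
by rewrite divnMDl// divn_small ?addn0 ?ltnS.
Qed.

Lemma sum_blocks j e w n :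
  (\sum_(1 <= i < (n * j.+1).+1) blocks j e w i =
   \sum_(q < n) (e q + \sum_(r < j) w q r))%N.
Proof.
rewrite big_add1/=; elim: n => [|n IH]; first by rewrite big_ord0 big_geq.
rewrite big_ord_recr/= -IH mulSnr (@big_cat_nat _ _ _ (n * j.+1)) ?leq_addr//=.
congr addn; rewrite -{1}[(n * j.+1)%N]add0n big_addn addKn big_mkord.
rewrite big_ord_recl /= add0n blocks0; congr addn; apply: eq_bigr => r _.
by rewrite /bump /= add1n addnC blocksS.
Qed.

(** The sum is the 2-adic valuation of [n!], hence by Legendre's formula the sum of the
    [n %/ 2 ^ k]. *)
Lemma sum_logn2 n : (\sum_(q < n) logn 2 q.+1 <= n)%N.
Proof.
have -> : (\sum_(q < n) logn 2 q.+1 = logn 2 n`!)%N.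
  elim: n => [|n IH]; first by rewrite big_ord0 logn1.
  by rewrite big_ord_recr factS lognM ?fact_gt0//= IH addnC.
(* The subtracted term makes the induction close, since each quotient is at least twice the next. *)
rewrite logn_fact//; suff H m : (\sum_(1 <= k < m.+1) n %/ 2 ^ k <= n - n %/ 2 ^ m)%N.
  exact: leq_trans (H n) (leq_subr _ _).
elim: m => [|m IH]; first by rewrite big_geq.
rewrite big_nat_recr//=.
have h : ((n %/ 2 ^ m.+1).*2 <= n %/ 2 ^ m)%N.
  by rewrite expnSr divnMA -muln2 leq_divM.
have h2 : (n %/ 2 ^ m <= n)%N by rewrite leq_div.
lia.
Qed.

(** * Partial sums, uniqueness and separation of expansions *)

Section Expansions.
Context {R : realType}.
Implicit Types (x y : R) (d : nat -> nat) (n : nat).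

Definition digit_sum d n := (\sum_(1 <= j < n.+1) d j)%N.
Definition expansion_sum d n : R := \sum_(1 <= i < n.+1) 2 ^- digit_sum d i.

Lemma digit_sum0 d : digit_sum d 0 = 0%N.
Proof. by rewrite /digit_sum big_geq. Qed.

Lemma digit_sumS d n : digit_sum d n.+1 = (digit_sum d n + d n.+1)%N.
Proof. by rewrite /digit_sum big_nat_recr. Qed.

Lemma leq_digit_sum d m n : (m <= n)%N -> (digit_sum d m <= digit_sum d n)%N.
Proof.
move=> /subnKC <-; elim: (n - m)%N => [|k IH]; first by rewrite addn0.
by rewrite addnS digit_sumS (leq_trans IH)// leq_addr.
Qed.

Lemma expansion_sumS d n :
  expansion_sum d n.+1 = expansion_sum d n + 2 ^- digit_sum d n.+1.
Proof. by rewrite /expansion_sum big_nat_recr. Qed.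

Lemma expansion_sum0 d : expansion_sum d 0 = 0.
Proof. by rewrite /expansion_sum big_geq. Qed.

Lemma nondecreasing_expansion_sum d :
  {homo expansion_sum d : m n / (m <= n)%N >-> m <= n}.
Proof.
apply/nondecreasing_seqP => n.
by rewrite expansion_sumS lerDl invr_ge0 exprn_ge0.
Qed.

Definition positive_digits d := forall i, (1 <= i)%N -> (1 <= d i)%N.

(** The term of index [n.+1] is at most half of [2 ^- digit_sum d n], because [d n.+1 >= 1]. The
    values are the right ends of nested intervals around the limit. *)
Lemma nonincreasing_expansion_sumD d : positive_digits d ->
  {homo (fun n => expansion_sum d n + 2 ^- digit_sum d n) :
    m n / (m <= n)%N >-> m >= n}.
Proof.
move=> d1; apply/nonincreasing_seqP => n.
rewrite expansion_sumS -addrA lerD2l digit_sumS -mulr2n exprD invfM.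
rewrite -mulrnAr ler_piMr ?invr_ge0 ?exprn_ge0//.
rewrite -mulr_natl ler_pdivrMr ?exprn_gt0// mul1r.
by rewrite -{1}[2]expr1 ler_weXn2l ?ler1n// d1.
Qed.

Lemma is_cvg_expansion_sum d : positive_digits d -> cvgn (expansion_sum d).
Proof.
move=> d1; apply: nondecreasing_is_cvgn; first exact: nondecreasing_expansion_sum.
exists 1 => _ [n _ <-].
have := nonincreasing_expansion_sumD d1 (leq0n n).
rewrite /= expansion_sum0 add0r digit_sum0 invr1.
by apply: le_trans; rewrite lerDl invr_ge0 exprn_ge0.
Qed.

Lemma expansion_bounds x d n : is_expansion x d ->
  expansion_sum d n <= x <= expansion_sum d n + 2 ^- digit_sum d n.
Proof.
move=> [d1 dx]; have {}dx : expansion_sum d @ \oo --> x by [].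
apply/andP; split.
  apply: (cvgr_to_ge dx); exists n => // m /= nm.
  exact: nondecreasing_expansion_sum.
apply: (cvgr_to_le dx); exists n => // m /= nm.
apply: le_trans (nonincreasing_expansion_sumD d1 nm).
by rewrite lerDl invr_ge0 exprn_ge0.
Qed.

Lemma expansion_itv x d : is_expansion x d -> 0 < x <= 1.
Proof.
move=> xd; have /andP[+ _] := expansion_bounds 1 xd.
have /andP[_] := expansion_bounds 0 xd.
rewrite expansion_sumS expansion_sum0 !add0r digit_sum0 invr1.
by move=> -> h; rewrite andbT (lt_le_trans _ h)// invr_gt0 exprn_gt0.
Qed.

(** With [E] the common partial sum before index [n], [y <= E + 2 * 2 ^- digit_sum d' n <= E + 2 ^-
    digit_sum d n], the last step because [d' n] is larger. The gap is the next term of [x], whence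
    the index [n.+1]. *)
Lemma expansion_separation x y d d' n : is_expansion x d -> is_expansion y d' ->
  (1 <= n)%N -> (forall i, (1 <= i < n)%N -> d i = d' i) -> (d n < d' n)%N ->
  2 ^- digit_sum d n.+1 <= x - y.
Proof.
case: n => // n xd yd' _ agree dn.
have agree_sum m : (m <= n)%N -> digit_sum d m = digit_sum d' m.
  move=> mn; apply: eq_big_nat => i /andP[i1 im]; apply: agree.
  by rewrite i1 (leq_trans im).
have eqn : expansion_sum d n = expansion_sum d' n.
  by apply: eq_big_nat => i /andP[i1 im]; rewrite agree_sum.
have /andP[xge _] := expansion_bounds n.+2 xd.
have /andP[_ yle] := expansion_bounds n.+1 yd'.
have : 2 * 2 ^- digit_sum d' n.+1 <= 2 ^- digit_sum d n.+1 :> R.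
  rewrite -[leLHS]invrK -[leRHS]invrK lef_pV2 ?posrE ?invr_gt0 ?mulr_gt0 ?invr_gt0 ?exprn_gt0//.
  rewrite !invfM !invrK mulrC ler_pdivlMr// -exprSr ler_weXn2l ?ler1n//.
  by rewrite !digit_sumS agree_sum// -addnS leq_add2l.
move: xge yle; rewrite !expansion_sumS eqn; lra.
Qed.

Lemma first_difference (f g : nat -> nat) m : f m != g m -> (1 <= m)%N ->
  exists n, [/\ (1 <= n <= m)%N, f n != g n &
    forall i, (1 <= i < n)%N -> f i = g i].
Proof.
move=> fg m1; have ex : exists n, (1 <= n)%N && (f n != g n) by exists m; rewrite m1.
case: (ex_minnP ex) => n /andP[n1 fgn] nmin; exists n; split => //.
  by rewrite n1 nmin// m1.
move=> i /andP[i1 ilt]; apply/eqP/negPn/negP => fgi.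
by move: (nmin i); rewrite i1 fgi => /(_ isT); rewrite leqNgt ilt.
Qed.

(** The first difference occurs at some [n <= m], and either number may be the larger one there; the
    maximum covers both cases. *)
Lemma expansion_distance x y d d' m : is_expansion x d -> is_expansion y d' ->
  (1 <= m)%N -> d m != d' m ->
  2 ^- maxn (digit_sum d m.+1) (digit_sum d' m.+1) <= `|x - y|.
Proof.
move=> xd yd' m1 dm; have [n [/andP[n1 nm] dn agree]] := first_difference dm m1.
have le_inv k l : (k <= l)%N -> 2 ^- l <= 2 ^- k :> R.
  by move=> kl; rewrite lef_pV2 ?posrE ?exprn_gt0// ler_weXn2l ?ler1n.
case: (ltngtP (d n) (d' n)) dn => // h _.
- apply: le_trans (ler_norm _).
  apply: le_trans (expansion_separation xd yd' n1 agree h).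
  by apply: le_inv; rewrite leq_max leq_digit_sum.
- rewrite distrC; apply: le_trans (ler_norm _).
  have agree' i : (1 <= i < n)%N -> d' i = d i by move=> /agree.
  apply: le_trans (expansion_separation yd' xd n1 agree' h).
  by apply: le_inv; rewrite leq_max (leq_digit_sum d') ?orbT.
Qed.

(** Two expansions of [x] that disagree at [i] would put [x] at positive distance from itself. *)
Lemma digitE x d i : is_expansion x d -> (1 <= i)%N -> digit i x = d i.
Proof.
move=> xd i1; rewrite /digit; case: xgetP => [d' _ xd'|/(_ d)//].
apply/eqP/negPn/negP => di.
have := expansion_distance xd' xd i1 di.
by rewrite subrr normr0 leNgt invr_gt0 exprn_gt0.
Qed.

Lemma max_digitE x d n : is_expansion x d ->
  max_digit n x = (\max_(1 <= i < n.+1) d i)%N.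
Proof.
move=> xd; rewrite /max_digit; apply: eq_big_nat => i /andP[i1 _].
exact: digitE.
Qed.

End Expansions.

(** * Base [M] digits, choice of the block length, growth of the maximal digit *)

Section Radix.
Context {R : realType}.
Implicit Types (u v : R) (M q n : nat).

Definition radix_digit M q u : nat := (Num.truncn (u * M%:R ^+ q.+1) %% M)%N.

Lemma truncn_div (x : R) M : 0 <= x -> (0 < M)%N ->
  Num.truncn (x / M%:R) = (Num.truncn x %/ M)%N.
Proof.
move=> x0 M0; have M0' : 0 < M%:R :> R by rewrite ltr0n.
have /andP[tx xt] := truncn_itv x0; apply: truncn_def.
rewrite ler_pdivlMr// ltr_pdivrMr// -!natrM (le_trans _ tx) ?ler_nat ?leq_divM//=.
by apply: lt_le_trans xt _; rewrite ler_nat -ltn_divLR.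
Qed.

Lemma truncn_radix M q u : 0 <= u -> (0 < M)%N ->
  (Num.truncn (u * M%:R ^+ q.+1) %/ M)%N = Num.truncn (u * M%:R ^+ q).
Proof.
move=> u0 M0; rewrite -truncn_div ?mulr_ge0 ?exprn_ge0//.
by rewrite exprSr mulrA mulfK// pnatr_eq0 -lt0n.
Qed.

(** The first [n] digits determine the integer part of [u * M ^ n], by Euclidean division by [M] at
    each step. *)
Lemma radix_digit_close M n u v : 0 <= u < 1 -> 0 <= v < 1 -> (0 < M)%N ->
  (forall q, (q < n)%N -> radix_digit M q u = radix_digit M q v) ->
  `|u - v| < M%:R ^- n.
Proof.
move=> /andP[u0 u1] /andP[v0 v1] M0 agree.
have M0' : 0 < M%:R :> R by rewrite ltr0n.
have : Num.truncn (u * M%:R ^+ n) = Num.truncn (v * M%:R ^+ n).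
  elim: n agree => [_|n IH agree].
    by rewrite !mulr1 !(@truncn_def _ _ 0)// ?u0 ?v0.
  rewrite (divn_eq (Num.truncn (u * _)) M) (divn_eq (Num.truncn (v * _)) M).
  rewrite !truncn_radix// IH => [|q qn]; last by rewrite agree// ltnW.
  by congr (_ + _)%N; apply: agree.
have /andP[] := truncn_itv (mulr_ge0 u0 (exprn_ge0 n (ltW M0'))).
have /andP[] := truncn_itv (mulr_ge0 v0 (exprn_ge0 n (ltW M0'))).
move=> + + + + e; rewrite e -!natr1 => h1 h2 h3 h4.
rewrite -[ltRHS]div1r ltr_pdivlMr ?exprn_gt0//.
rewrite -{1}(@ger0_norm _ (M%:R ^+ n)) ?exprn_ge0 ?ltW// -normrM mulrBl ltr_norml.
by apply/andP; split; lra.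
Qed.

Lemma bernoulli_le (h : R) n : 0 <= h -> 1 + n%:R * h <= (1 + h) ^+ n.
Proof.
move=> h0; elim: n => [|n IH]; first by rewrite mul0r addr0 expr0.
rewrite exprS -natr1; apply: le_trans (ler_wpM2l _ IH); last by lra.
have : 0 <= n%:R * h * h by rewrite !mulr_ge0.
lra.
Qed.

Lemma radix_digit_differ M u v : 0 <= u < 1 -> 0 <= v < 1 -> (1 < M)%N -> u != v ->
  exists2 q, radix_digit M q u != radix_digit M q v & `|u - v| <= M%:R ^- q.
Proof.
move=> hu hv M1 uv; have M0 : (0 < M)%N by exact: ltnW.
have M0' : 0 < M%:R :> R by rewrite ltr0n.
have ex : exists q, radix_digit M q u != radix_digit M q v.
  apply: contrapT => /forallNP agree.
  have uv0 : 0 < `|u - v| by rewrite normr_gt0 subr_eq0.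
  (* Full agreement would give [|u - v| < M ^- n] for every [n]; this [n] exceeds [|u - v|^-1] and
     is below [M ^ n]. *)
  pose n := (Num.truncn (`|u - v|^-1)).+1.
  have agree' q : (q < n)%N -> radix_digit M q u = radix_digit M q v.
    by move=> _; apply/eqP/negPn/negP/agree.
  have := radix_digit_close hu hv M0 agree'.
  rewrite -[ltRHS]div1r ltr_pdivlMr ?exprn_gt0// -ltr_pdivlMl// mulr1.
  apply/negP; rewrite -leNgt.
  apply: le_trans (ltW (truncnS_gt _)) _; rewrite -/n -natrX ler_nat.
  exact/ltnW/ltn_expl.
case: (ex_minnP ex) => q dq qmin; exists q => //.
apply/ltW/radix_digit_close => // p pq; apply/eqP/negPn/negP => /qmin.
by rewrite leqNgt pq.
Qed.

(** [j.*2.+1 + a] will bound the average digit sum of a block, so each block offers enough words for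
    the exponent [s]. For large [j], [4 ^ j] exceeds [4 ^ (j * s)] by an exponential factor, which
    beats the polynomial loss [j.*2.+1]. *)
Lemma exists_word_length (s : R) (a : nat) : 0 <= s < 1 ->
  exists2 j : nat, (0 < j)%N & 2 `^ ((j.*2.+1 + a)%:R * s) <= 'C(j.*2, j)%:R.
Proof.
move=> /andP[s0 s1].
(* [r ^+ j ^+ 2] is the gain [4 ^ (j * (1 - s))]; [D] collects the part of the exponent independent
   of [j]. *)
pose r : R := 2 `^ (1 - s); pose h := r - 1; pose D : R := 2 `^ (a.+1%:R * s).
have D0 : 0 < D by exact: powR_gt0.
have h0 : 0 < h.
  have -> : 0 < h = (1 `^ (1 - s) < r) by rewrite powR1 subr_gt0.
  by apply: gt0_ltr_powR; rewrite ?nnegrE ?subr_gt0 ?ltr1n.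
(* Bernoulli gives [r ^+ j >= j * h], so this choice yields [r ^+ j ^+ 2 >= 3 * j * D >= (2 * j + 1)
   * D]. *)
pose j := (Num.truncn (3 * D / h ^+ 2)).+1.
have jh : 3 * D <= j%:R * h ^+ 2.
  by rewrite -ler_pdivrMr ?exprn_gt0// ltW// truncnS_gt.
have j0 : (0 < j)%N by [].
clearbody j; exists j => //.
have j1 : 1 <= j%:R :> R by rewrite ler1n.
clear j0.
have jj : j.*2.+1%:R = 2 * j%:R + 1 :> R by rewrite -natr1 -muln2 natrM mulrC.
suff : j.*2.+1%:R * 2 `^ ((j.*2.+1 + a)%:R * s) <= (4 ^ j)%:R.
  move=> H; rewrite -(@ler_pM2l _ j.*2.+1%:R) ?ltr0n//; apply: le_trans H _.
  by rewrite -natrM ler_nat exp4_le_central_bin.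
have -> : 2 `^ ((j.*2.+1 + a)%:R * s) = D * 2 `^ (j.*2%:R * s).
  rewrite -powRD; last by rewrite pnatr_eq0 implybT.
  by congr (_ `^ _); rewrite -mulrDl -natrD; congr (_%:R * _); lia.
have -> : (4 ^ j)%:R = r ^+ j ^+ 2 * 2 `^ (j.*2%:R * s) :> R.
  rewrite -exprM muln2 -powR_mulrn ?powR_ge0// -powRrM -powRD; last first.
    by rewrite pnatr_eq0 implybT.
  rewrite [X in _ `^ X](_ : _ = j.*2%:R); last by ring.
  by rewrite powR_mulrn// -muln2 mulnC exprM natrX; congr (_ ^+ _); ring.
rewrite mulrA ler_wpM2r ?powR_ge0//.
have b : j%:R * h <= r ^+ j.
  have -> : r = 1 + h by rewrite /h addrC subrK.
  by apply: le_trans (bernoulli_le j (ltW h0)); rewrite lerDr.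
have b2 : (j%:R * h) ^+ 2 <= r ^+ j ^+ 2 by rewrite ler_sqr ?nnegrE ?exprn_ge0 ?powR_ge0 ?mulr_ge0// ltW.
apply: le_trans b2; rewrite jj exprMn expr2 -mulrA.
apply: (@le_trans _ _ (j%:R * (3 * D))); last by rewrite ler_wpM2l.
rewrite mulrA ler_wpM2r ?(ltW D0)//; lra.
Qed.

Lemma cvg_div_log2 (f : nat -> R) (alpha C : R) :
  (forall n, (0 < n)%N -> `|f n - alpha * log2 n%:R| <= C) ->
  f n / log2 n%:R @[n --> \oo] --> alpha.
Proof.
move=> fC; have C0 : 0 <= C by apply: le_trans (fC 1%N isT).
have l2 : 0 < ln 2 :> R by rewrite ln_gt0// ltr1n.
apply/cvgrPdist_le => e e0.
(* Chosen so that [n >= expR A] forces [log2 n >= C / e + 1]; the added 1 keeps the logarithm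
   positive. *)
pose A := (C / e + 1) * ln 2.
have A0 : 0 <= A by rewrite mulr_ge0 ?(ltW l2)// addr_ge0// divr_ge0// ltW.
exists (Num.truncn (expR A)).+1 => // n /= hn.
have hA : C / e + 1 <= log2 n%:R.
  rewrite /log2 ler_pdivlMr// -[leLHS]expRK ler_ln ?posrE ?expR_gt0//.
    by rewrite (le_trans (ltW (truncnS_gt _)))// ler_nat.
  by rewrite ltr0n (leq_trans _ hn).
have n0 : (0 < n)%N by exact: leq_trans hn.
have L0 : 0 < log2 (n%:R : R).
  by apply: lt_le_trans hA; rewrite ltr_wpDl// divr_ge0// ltW.
have -> : alpha - f n / log2 n%:R = - ((f n - alpha * log2 n%:R) / log2 n%:R).
  by rewrite mulrBl mulfK ?gt_eqF// opprB.
rewrite normrN normf_div (gtr0_norm L0) ler_pdivrMr//; apply: le_trans (fC n n0) _.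
by rewrite -ler_pdivrMl// mulrC; apply: le_trans hA; rewrite lerDl.
Qed.

Definition log_digit (alpha : R) q : nat := (Num.truncn (alpha * (logn 2 q.+1)%:R)).+1.

(** The first [n] digits meet [W] blocks. The largest 2-adic valuation among [1..W] is [k], attained
    at [2 ^ k], and [k] is within [1 + log2 j.+1] of [log2 n]. The free digits are bounded and
    affect only the constant. *)
Lemma max_blocks_log alpha j w : 0 < alpha ->
  (forall q r, w q r <= j.+1)%N ->
  exists C, forall n, (0 < n)%N ->
    `|(\max_(1 <= i < n.+1) blocks j (log_digit alpha) w i)%N%:R
      - alpha * log2 n%:R| <= C.
Proof.
move=> a0 wj; have l2 : 0 < ln 2 :> R by rewrite ln_gt0// ltr1n.
exists (j%:R + 2 + alpha * (1 + log2 j.+1%:R)) => n n0.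
set m := (\max_(_ <= _ < _) _)%N.
pose W := (n.-1 %/ j.+1).+1; pose k := trunc_log 2 W.
have /andP[kW Wk] : (2 ^ k <= W < 2 ^ k.+1)%N by exact: trunc_log_bounds.
have m_ge : alpha * k%:R <= m%:R.
  apply: (@le_trans _ _ (log_digit alpha (2 ^ k).-1)%:R).
    by rewrite /log_digit prednK ?expn_gt0// pfactorK// ltW// truncnS_gt.
  rewrite ler_nat -(@blocks0 j (log_digit alpha) w) /m.
  have hi : (((2 ^ k).-1 * j.+1) < n)%N.
    rewrite -[ltnRHS]prednK// ltnS; apply: leq_trans (leq_divM n.-1 j.+1).
    by rewrite leq_mul2r/= -ltnS prednK ?expn_gt0.
  apply: (@leq_bigmax_seq _ _ xpredT) => //.
  by rewrite mem_index_iota.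
have m_le : m%:R <= alpha * k%:R + j%:R + 1.
  have ak0 : 0 <= alpha * k%:R by rewrite mulr_ge0// ltW.
  apply: (@le_trans _ _ (maxn j.+1 (Num.truncn (alpha * k%:R)).+1)%:R).
    rewrite ler_nat; apply/bigmax_leqP_seq => i; rewrite mem_index_iota => /andP[i1 im] _.
    rewrite /blocks; case: (_ %% _)%N => [|r]; last by rewrite leq_max wj.
    rewrite leq_max /log_digit; apply/orP; right; rewrite ltnS.
    apply: le_truncn; rewrite ler_pM2l// ler_nat; apply: trunc_log_max => //.
    apply: (@leq_trans (i.-1 %/ j.+1).+1); last by rewrite ltnS leq_div2r//; lia.
    by apply: dvdn_leq => //; exact: pfactor_dvdnn.
  have := ler0n R j; have /andP[+ _] := truncn_itv ak0.
  rewrite /maxn; case: ifP => _; rewrite -natr1; lra.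
have ln_exp i : log2 (2 ^ i)%:R = i%:R :> R.
  by rewrite /log2 natrX lnXn// -[_ *+ i]mulr_natl mulfK ?gt_eqF.
have log2_le (x y : R) : 0 < x -> x <= y -> log2 x <= log2 y.
  by move=> x0 xy; rewrite /log2 ler_pM2r ?invr_gt0// ler_ln ?posrE// (lt_le_trans x0).
have L_ge : k%:R <= log2 n%:R :> R.
  rewrite -ln_exp; apply: log2_le; rewrite ?ltr0n ?expn_gt0// ler_nat.
  apply: leq_trans kW _; rewrite -[leqRHS]prednK// ltnS; exact: leq_div.
have L_le : log2 n%:R <= k%:R + (1 + log2 j.+1%:R) :> R.
  rewrite addrA natr1 -(ln_exp k.+1).
  have -> : log2 (2 ^ k.+1)%:R + log2 j.+1%:R = log2 (2 ^ k.+1 * j.+1)%:R :> R.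
    by rewrite /log2 -mulrDl natrM lnM ?posrE ?ltr0n ?expn_gt0.
  apply: log2_le; rewrite ?ltr0n// ler_nat.
  apply: (@leq_trans (W * j.+1)); last by rewrite leq_mul2r/= ltnW.
  by rewrite -[leqLHS]prednK// ltn_ceil.
have j0 : 0 <= log2 (j.+1%:R : R).
  by rewrite /log2 divr_ge0 ?ln_ge0 ?ler1n// ltW.
have := ler_wpM2l (ltW a0) L_ge; have := ler_wpM2l (ltW a0) L_le.
have : 0 <= alpha * (1 + log2 j.+1%:R) by rewrite mulr_ge0 ?addr_ge0 ?(ltW a0).
rewrite mulrDr ler_norml; move=> ? ? ?; apply/andP; split.
  have := ler0n R j; lra.
lra.
Qed.

End Radix.

(** * The coding map and its inverse Hölder estimate *)

Section HolderCoding.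
Context {R : realType}.

Definition log_max_set (alpha : R) : set R :=
  [set x | 0 < x <= 1 /\
     (max_digit n x)%:R / log2 n%:R @[n --> \oo] --> alpha].

(** A block costs at most [j.*2.+1] plus [a] times its valuation, and the valuations of [n] blocks
    sum to at most [n]. *)
Lemma digit_sum_blocks_log (alpha : R) j (w : nat -> nat -> nat) a n :
  0 < alpha -> alpha <= a%:R ->
  (forall q, \sum_(r < j) w q r <= j.*2)%N ->
  (digit_sum (blocks j (log_digit alpha) w) (n * j.+1) <= n * (j.*2.+1 + a))%N.
Proof.
move=> a0 aa sum_w; rewrite /digit_sum sum_blocks.
apply: (@leq_trans (\sum_(q < n) (j.*2.+1 + a * logn 2 q.+1))%N).
  apply: leq_sum => q _; rewrite addSnnS addnC leq_add// /log_digit ltnS.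
  have h0 : 0 <= alpha * (logn 2 q.+1)%:R by rewrite mulr_ge0// ltW.
  rewrite -(ler_nat R) natrM; have /andP[+ _] := truncn_itv h0.
  by move=> /le_trans; apply; rewrite ler_wpM2r.
rewrite big_split/= sum_nat_const card_ord mulnDr leq_add2l -big_distrr/= mulnC.
by rewrite leq_mul2r sum_logn2 orbT.
Qed.

Lemma exists_holder_coding (alpha s : R) : 0 < alpha -> 0 <= s < 1 ->
  exists2 g : R -> R, (forall u, log_max_set alpha (g u)) &
  exists2 C : R, 0 < C & forall u v, 0 <= u < 1 -> 0 <= v < 1 ->
    `|u - v| <= C * `|g u - g v| `^ s.
Proof.
move=> a0 hs; pose a := (Num.truncn alpha).+1.
have aa : alpha <= a%:R by rewrite ltW// truncnS_gt.
have [j j0 hj] := exists_word_length a hs.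
have [w [w_itv sum_w w_inj]] := exists_words j.
set M := 'C(j.*2, j) in hj w_inj *.
(* [j.*2.+1 < 4 ^ j <= j.*2.+1 * M]. *)
have M1 : (1 < M)%N.
  have := @exp4_le_central_bin j; rewrite -/M.
  have : (j.*2.+1 < 4 ^ j)%N.
    elim: (j) j0 => // -[//|i] IH _; have := IH isT; rewrite (expnS 4 i.+1); lia.
  by case: (M) => [|[|//]]; rewrite ?muln0 ?muln1; lia.
have M0 : 0 < M%:R :> R by rewrite ltr0n ltnW.
pose d (u : R) := blocks j (log_digit alpha) (fun q => w (radix_digit M q u)).
have d1 u : positive_digits (d u).
  move=> i _; rewrite /d /blocks; case: (_ %% _)%N => // r.
  by have /andP[] := w_itv (radix_digit M (i.-1 %/ j.+1) u) r.
pose g u := limn (expansion_sum (d u) : nat -> R).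
have gd u : is_expansion (g u) (d u) by split; [exact: d1|exact: is_cvg_expansion_sum].
exists g.
  move=> u; split; first exact: expansion_itv (gd u).
  have [|C hC] := @max_blocks_log R alpha j (fun q => w (radix_digit M q u)) a0.
    by move=> q r; have /andP[] := w_itv (radix_digit M q u) r.
  apply: (@cvg_div_log2 _ _ _ C) => n n0.
  by rewrite (max_digitE _ (gd u)); exact: hC.
(* The square pays for the two blocks by which [M ^- q.+2] falls short of [M ^- q]. *)
exists (M%:R ^+ 2) => [|u v hu hv]; first by rewrite exprn_gt0.
have [->|uv] := eqVneq u v.
  by rewrite subrr normr0 mulr_ge0 ?powR_ge0// exprn_ge0.
have [q dq uvq] := radix_digit_differ hu hv M1 uv.
have radix_lt x : (radix_digit M q x < M)%N by rewrite ltn_mod ltnW.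
have [r rj wr] : exists2 r, (r < j)%N &
    w (radix_digit M q u) r != w (radix_digit M q v) r.
  apply: contrapT => /forall2NP h; move/eqP: dq; apply.
  apply: w_inj => // r rj; apply/eqP/negPn/negP => wr.
  by have [|] := h r.
pose B := (j.*2.+1 + a)%N.
(* The words of block [q] differ, and the separation uses one digit beyond the difference, which may
   be the first of block [q.+1]; hence [q.+2] blocks. *)
have dist : 2 ^- (q.+2 * B) <= `|g u - g v|.
  have hd : d u (q * j.+1 + r.+1).+1 != d v (q * j.+1 + r.+1).+1.
    by rewrite /d !blocksS.
  apply: le_trans (expansion_distance (gd u) (gd v) (ltn0Sn _) hd).
  rewrite lef_pV2 ?posrE ?exprn_gt0// ler_weXn2l ?ler1n//.
  have le_sum x : (digit_sum (d x) (q * j.+1 + r.+1).+2 <= q.+2 * B)%N.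
    apply: (@leq_trans (digit_sum (d x) (q.+2 * j.+1))).
      by apply: leq_digit_sum; rewrite !mulSn; clear -rj; lia.
    exact: (@digit_sum_blocks_log alpha j _ a).
  by rewrite geq_max !le_sum.
have /andP[s0 s1] := hs.
have : (2 ^- (q.+2 * B)) `^ s <= `|g u - g v| `^ s.
  by apply: ge0_ler_powR => //; rewrite nnegrE ?invr_ge0 ?exprn_ge0.
have -> : (2 ^- (q.+2 * B)) `^ s = (2 `^ (B%:R * s)) ^- q.+2 :> R.
  rewrite -(@powR_invn _ 2)// -powRrM -(@powR_invn _ (2 `^ _)) ?powR_ge0//.
  by rewrite -powRrM natrM; congr (_ `^ _); ring.
move=> dist_s.
have : M%:R ^- q.+2 <= `|g u - g v| `^ s.
  apply: le_trans dist_s; rewrite lef_pV2 ?posrE ?exprn_gt0 ?powR_gt0//.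
  by rewrite lerXn2r ?nnegrE ?powR_ge0 ?(ltW M0).
move=> /(ler_wpM2l (exprn_ge0 2 (ltW M0))); apply: le_trans.
by apply: le_trans uvq _; rewrite -(addn2 q) exprD invfM mulrCA divff ?mulr1// gt_eqF// exprn_gt0.
Qed.

End HolderCoding.

(** * Upper and lower bounds for Hausdorff measures *)

Section HausdorffDimension.
Context {R : realType}.
Implicit Types (A U : set R) (s delta : R).

Lemma diam_ge0 U : (0 <= diam U)%E.
Proof. by apply: ereal_sup_ubound; left. Qed.

Lemma le_diam U x y : U x -> U y -> (`|x - y|%:E <= diam U)%E.
Proof. by move=> Ux Uy; apply: ereal_sup_ubound; right; exists x => //; exists y. Qed.

Lemma diam_le U delta : 0 <= delta ->
  (forall x y, U x -> U y -> `|x - y| <= delta) -> (diam U <= delta%:E)%E.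
Proof.
move=> d0 Ud; apply: ge_ereal_sup => _ [->|[x Ux [y Uy <-]]]; rewrite lee_fin//.
exact: Ud.
Qed.

Lemma diam_pow_ge0 s U : (0 <= diam_pow s U)%E.
Proof. by rewrite /diam_pow; case: ifP => // _; exact: poweR_ge0. Qed.

Lemma diam_pow_le s delta U : 0 <= s -> 0 <= delta -> (diam U <= delta%:E)%E ->
  (diam_pow s U <= (delta `^ s)%:E)%E.
Proof.
move=> s0 d0 Ud; rewrite /diam_pow; case: ifP => _; first by rewrite lee_fin powR_ge0.
rewrite -poweR_EFin; apply: gt0_ler_poweR => //.
  by rewrite in_itv/= diam_ge0 leey.
by rewrite in_itv/= lee_fin d0 leey.
Qed.

Lemma hausdorff_content_ge0 delta s A : (0 <= hausdorff_content delta s A)%E.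
Proof.
apply: le_ereal_inf_tmp => _ [F _ <-].
by apply: nneseries_ge0 => i _ _; exact: diam_pow_ge0.
Qed.

Lemma hausdorff_content_unit_itv delta s A n : 0 <= s -> A `<=` `[0, 1] ->
  n.+1%:R^-1 <= delta ->
  (hausdorff_content delta s A <= (n.+2%:R * n.+1%:R^-1 `^ s)%:E)%E.
Proof.
move=> s0 A01 nd; have n0 : 0 < n.+1%:R :> R by [].
(* Pieces are indexed by the integer part of [x * n.+1]; the index [n.+1] receives [x = 1], whence
   [n.+2] pieces. *)
pose F i : set R :=
  if (i < n.+2)%N then `[i%:R / n.+1%:R, i.+1%:R / n.+1%:R]%classic else set0.
have diamF i : (diam (F i) <= n.+1%:R^-1%:E)%E.
  apply: diam_le => [|x y]; first by rewrite invr_ge0.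
  rewrite /F; case: ifP => // _; rewrite /= !in_itv/= -[i.+1%:R]natr1 mulrDl mul1r.
  move: (i%:R / n.+1%:R : R) (n.+1%:R^-1 : R) => a b /andP[? ?] /andP[? ?].
  by rewrite ler_norml; apply/andP; split; lra.
apply: ge_ereal_inf; exists (\sum_(0 <= i <oo) diam_pow s (F i))%E.
  exists F => //; split => [x /A01|i]; last first.
    by apply: le_trans (diamF i) _; rewrite lee_fin.
  rewrite /= in_itv/= => /andP[x0 x1]; exists (Num.truncn (x * n.+1%:R)) => //.
  have xn0 : 0 <= x * n.+1%:R by rewrite mulr_ge0// ltW.
  have /andP[h1 h2] := truncn_itv xn0.
  have lt_n : (Num.truncn (x * n.+1%:R) < n.+2)%N.
    by rewrite truncn_lt_nat// -[n.+2%:R]natr1 ltr_pwDr// ler_piMl.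
  by rewrite /F lt_n /= in_itv/= ler_pdivrMr// ler_pdivlMr// h1 ltW.
rewrite (@nneseries_split _ _ 0 n.+2) => [|i _]; last exact: diam_pow_ge0.
rewrite add0n [X in (_ + X)%E]eseries0 ?adde0 => [|i ni _]; last first.
  by rewrite /diam_pow /F ltnNge ni/= eqxx.
rewrite big_mkord; apply: (@le_trans _ _ (\sum_(i < n.+2) (n.+1%:R^-1 `^ s)%:E)%E).
  by apply: lee_sum => i _; apply: diam_pow_le => //; rewrite invr_ge0.
by rewrite sumEFin lee_fin sumr_const card_ord mulr_natl.
Qed.

Lemma hausdorff_measure_unit_itv s A : 1 < s -> A `<=` `[0, 1] ->
  hausdorff_measure s A = 0%E.
Proof.
move=> s1 A01; apply/eqP; rewrite eq_le; apply/andP; split; last first.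
  apply: le_trans (hausdorff_content_ge0 1 s A) _.
  by apply: ereal_sup_ubound; exists 1 => //=; exact: ltr01.
apply: ge_ereal_sup => _ [delta /= d0 <-].
apply/lee_addgt0Pr => e e0; rewrite add0e.
(* The first summand makes the mesh at most [delta]; the second gives [n.+1 ^ (s - 1) >= 2 / e], so
   the content is at most [2 * n.+1 ^ (1 - s) <= e]. *)
pose n := Num.truncn (delta^-1 + (2 / e) `^ (s - 1)^-1).
have n0 : 0 < n.+1%:R :> R by [].
have p0 : 0 <= (2 / e) `^ (s - 1)^-1 by exact: powR_ge0.
have hn : delta^-1 + (2 / e) `^ (s - 1)^-1 <= n.+1%:R by rewrite ltW// truncnS_gt.
have nd : n.+1%:R^-1 <= delta.
  rewrite -[leRHS]invrK lef_pV2 ?posrE ?invr_gt0//.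
  by apply: le_trans hn; rewrite lerDl.
apply: le_trans (hausdorff_content_unit_itv _ A01 nd) _; first by lra.
rewrite lee_fin.
have h : 2 / e <= n.+1%:R `^ (s - 1).
  have -> : 2 / e = ((2 / e) `^ (s - 1)^-1) `^ (s - 1).
    by rewrite -powRrM mulVf ?powRr1 ?divr_ge0// ?(ltW e0)// gt_eqF// subr_gt0.
  apply: ge0_ler_powR; rewrite ?nnegrE// ?subr_ge0 ?(ltW s1)//.
  by apply: le_trans hn; rewrite lerDr invr_ge0 ltW.
have -> : n.+1%:R^-1 `^ s = n.+1%:R^-1 / n.+1%:R `^ (s - 1) :> R.
  rewrite -powRN -powR_inv1 ?(ltW n0)// -powRrM -powRD; last by rewrite pnatr_eq0 implybT.
  by congr (_ `^ _); ring.
rewrite mulrA ler_pdivrMr ?powR_gt0// ler_pdivrMr//.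
rewrite ler_pdivrMr// in h.
apply: (@le_trans _ _ (2 * n.+1%:R)).
  by rewrite -natrM ler_nat; lia.
by rewrite ler_wpM2r ?(ltW n0)// mulrC.
Qed.

(* The intervals of radius [C (diam F_i) ^ s] around points of [g^-1 F_i] cover
   [0, 1[, so that their lengths sum to at least 1. *)
Lemma hausdorff_measure_holder (A : set R) s (C : R) (g : R -> R) :
  0 <= s -> 0 < C -> (forall u, A (g u)) ->
  (forall u v, 0 <= u < 1 -> 0 <= v < 1 -> `|u - v| <= C * `|g u - g v| `^ s) ->
  hausdorff_measure s A <> 0%E.
Proof.
move=> s0 C0 Ag holder HA.
suff : (((C *+ 2)^-1)%:E <= hausdorff_measure s A)%E.
  by rewrite HA lee_fin leNgt invr_gt0 pmulrn_rgt0 ?C0.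
(* Scale 1 suffices: the bound on diameters serves only to make them finite. *)
apply: (@le_trans _ _ (hausdorff_content 1 s A)); last first.
  by apply: ereal_sup_ubound; exists 1 => //=; exact: ltr01.
apply: le_ereal_inf_tmp => _ [F [AF diamF] <-].
have cover_itv i : exists I : set R, [/\ measurable I,
    [set u | 0 <= u < 1 /\ F i (g u)] `<=` I &
    (lebesgue_measure I <= (C *+ 2)%:E * diam_pow s (F i))%E].
  have [[u0 [hu0 Fu0]]|/forallNP noF] :=
      pselect (exists u, 0 <= u < 1 /\ F i (g u)); last first.
    exists set0; split => //.
    by rewrite measure0 mule_ge0 ?diam_pow_ge0// lee_fin mulrn_wge0// ltW.
  have Ffin : diam (F i) = (fine (diam (F i)))%:E.
    rewrite fineK// ge0_fin_numE ?diam_ge0//; apply: le_lt_trans (diamF i) _.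
    exact: ltry.
  set D := fine (diam (F i)) in Ffin.
  have D0 : 0 <= D by rewrite fine_ge0// diam_ge0.
  have powF : diam_pow s (F i) = (D `^ s)%:E.
    rewrite /diam_pow ifF; first by rewrite Ffin poweR_EFin.
    by apply/negP => /eqP F0; rewrite F0 in Fu0.
  have r0 : 0 <= C * D `^ s by rewrite mulr_ge0 ?powR_ge0// ltW.
  exists `[u0 - C * D `^ s, u0 + C * D `^ s]%classic; split.
  - exact: measurable_itv.
  - move=> u /= [hu Fu]; rewrite in_itv/= -ler_distlC.
    apply: le_trans (holder _ _ hu0 hu) _; rewrite ler_wpM2l ?(ltW C0)//.
    apply: ge0_ler_powR; rewrite ?nnegrE//.
    by rewrite -lee_fin -Ffin; exact: le_diam.
  - rewrite lebesgue_measure_itv/= powF; case: ifP => _; last first.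
      by rewrite -EFinM lee_fin mulr_ge0 ?powR_ge0// mulrn_wge0// ltW.
    by rewrite -EFinB -EFinM lee_fin mulr2n mulrDl; lra.
have [I HI] := choice cover_itv.
have : (lebesgue_measure (`[0%R, 1%R[%classic : set R) <=
        \sum_(0 <= i <oo) lebesgue_measure (I i))%E.
  apply: measure_sigma_subadditive.
  - by move=> i; have [] := HI i.
  - exact: measurable_itv.
  - move=> u /=; rewrite in_itv/= => hu; have [i _ Fi] := AF _ (Ag u).
    by exists i => //; have [_ + _] := HI i; apply.
rewrite lebesgue_measure_itv/= lte_fin ltr01 sube0 => le1.
have : (1 <= (C *+ 2)%:E * \sum_(0 <= i <oo) diam_pow s (F i))%E.
  rewrite -nneseriesZl => [|i _]; last exact: diam_pow_ge0.
  by apply: le_trans le1 _; apply: lee_nneseries => // i _; have [] := HI i.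
by rewrite -lee_pdivrMl ?mule1// pmulrn_rgt0.
Qed.

End HausdorffDimension.

Theorem corollary1p1 (R : realType) (alpha : R) (alpha_gt0 : 0 < alpha) :
  hausdorff_dim
    [set x : R | 0 < x <= 1 /\
       (max_digit n x)%:R / log2 n%:R @[n --> \oo] --> alpha] = 1%E.
Proof.
apply/eqP; rewrite eq_le; apply/andP; split.
  apply/lee_addgt0Pr => e e0; rewrite -EFinD.
  apply: ereal_inf_lbound; exists (1 + e) => //; split; first by lra.
  apply: hausdorff_measure_unit_itv; first by lra.
  by move=> x [/andP[x0 x1] _]; rewrite /= in_itv/= x1 ltW.
(* An [s < 1] of zero measure would contradict the coding map built for that exponent. *)
apply: le_ereal_inf_tmp => _ [s [s0 Hs] <-]; rewrite lee_fin leNgt; apply/negP => s1.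
have [|g Ag [C C0 holder]] := @exists_holder_coding _ alpha s alpha_gt0.
  by rewrite s0 s1.
exact: (hausdorff_measure_holder s0 C0 Ag holder).
Qed.
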